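(* Let $G$ and $F$ be completable graphs on $\{1,\dots,n\}$, let $A(G)$ be a $G$-partial positive definite matrix and $B(F)$ an $F$-partial positive definite matrix, and let $t\in[0,1]$. Then there exists a unique $H\in A(G)\#_tB(F)$ such that $$\det(H)=\max\{\det(M\#_tN): M\#_tN\in A(G)\#_tB(F)\}.$$ Furthermore $H=\widehat{A}\#_t\widehat{B}$, where $\widehat{A},\widehat{B}$ are the maximum determinant positive definite completions of $A(G),B(F)$.
   Context: A graph $G=(V,E)$ is a finite undirected graph on $V=\{1,\dots,n\}$ containing all loops. A $G$-partial matrix has entries specified exactly for $\{i,j\}\in E$; a completion agrees with it on $E$. It is partial positive definite if Hermitian on $E$ and every principal submatrix indexed by a clique is positive definite. $G$ is completable if every $G$-partial positive semidefinite matrix has a positive semidefinite completion (equivalently chordal). $\mathfrak{p}^+[\cdot]$ is the set of positive definite completions; the maximum determinant positive definite completion is its unique element of largest determinant. For positive definite $M,N$, $M\#_tN:=M^{1/2}(M^{-1/2}NM^{-1/2})^tM^{1/2}$, and $A(G)\#_tB(F):=\{M\#_tN: M\in\mathfrak{p}^+[A(G)],\ N\in\mathfrak{p}^+[B(F)]\}$. *)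

(* Defs.v *)
From HB Require Import structures.
From mathcomp Require Import all_boot all_order all_algebra.
From mathcomp Require Import spectral.
From mathcomp Require Import complex.
From mathcomp Require Import reals exp.

Set Implicit Arguments.
Unset Strict Implicit.
Unset Printing Implicit Defensive.

Import Order.TTheory GRing.Theory Num.Theory.
Local Open Scope ring_scope.

Section Defs.
Variable R : realType.
Local Notation C := (complex R).

Definition ctr m k (A : 'M[C]_(m, k)) : 'M[C]_(k, m) := map_mx Num.conj (A^T).

Definition hermitian k (A : 'M[C]_k) : Prop := ctr A = A.

Definition pdmx k (A : 'M[C]_k) : Prop :=
  hermitian A /\ forall x : 'cV[C]_k, x != 0 -> 0 < (ctr x *m A *m x) 0 0.
Definition psdmx k (A : 'M[C]_k) : Prop :=
  hermitian A /\ forall x : 'cV[C]_k, 0 <= (ctr x *m A *m x) 0 0.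

Variable n : nat.

Definition is_graph (G : rel 'I_n) : Prop := symmetric G /\ reflexive G.

Definition clique (G : rel 'I_n) (S : {set 'I_n}) : Prop :=
  forall i j, i \in S -> j \in S -> G i j.

Definition princ_sub (A : 'M[C]_n) (S : {set 'I_n}) : 'M[C]_#|S| :=
  \matrix_(i, j) A (enum_val i) (enum_val j).

(* A G-partial matrix is represented by an n x n matrix of which only the
   entries indexed by edges of G are relevant. *)
Definition partial_pd (G : rel 'I_n) (A : 'M[C]_n) : Prop :=
  (forall i j, G i j -> A i j = Num.conj (A j i)) /\
  (forall S, clique G S -> pdmx (princ_sub A S)).
Definition partial_psd (G : rel 'I_n) (A : 'M[C]_n) : Prop :=
  (forall i j, G i j -> A i j = Num.conj (A j i)) /\
  (forall S, clique G S -> psdmx (princ_sub A S)).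

Definition completion (G : rel 'I_n) (A M : 'M[C]_n) : Prop :=
  forall i j, G i j -> M i j = A i j.

Definition completable (G : rel 'I_n) : Prop :=
  forall A, partial_psd G A -> exists M, completion G A M /\ psdmx M.

Definition pd_completion (G : rel 'I_n) (A M : 'M[C]_n) : Prop :=
  completion G A M /\ pdmx M.

Definition maxdet_completion (G : rel 'I_n) (A M : 'M[C]_n) : Prop :=
  pd_completion G A M /\
  forall N, pd_completion G A N -> \det N <= \det M.

(* real power of a (positive definite) matrix via its spectral decomposition
   X = P^-1 diag(d) P (P unitary): X^r := P^-1 diag(d^r) P *)
Definition powm (X : 'M[C]_n) (r : R) : 'M[C]_n :=
  invmx (spectralmx X) *m
  diag_mx (\row_i ((complex.Re (spectral_diag X 0 i)) `^ r)%:C%C) *m spectralmx X.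

Definition gmean (M N : 'M[C]_n) (t : R) : 'M[C]_n :=
  powm M (2^-1) *m
  powm (powm M (- 2^-1) *m N *m powm M (- 2^-1)) t *m powm M (2^-1).

End Defs.

(* Main.v *)
Require Import Defs.
From HB Require Import structures.
From mathcomp Require Import all_boot all_order all_algebra.
From mathcomp Require Import spectral complex.
From mathcomp Require Import reals exp.
From mathcomp Require Import boolp classical_sets topology normedtype derive.
From mathcomp Require Import ring lra.
(* [Defs.hermitian] would otherwise be shadowed by the one of [sesquilinear]. *)
Import Defs.
Import Order.TTheory GRing.Theory Num.Theory.
Import numFieldNormedType.Exports.
Local Open Scope ring_scope.

Set Implicit Arguments.
Unset Strict Implicit.
Unset Printing Implicit Defensive.

(** Since det (M #_t N) = (det M)^(1-t) (det N)^t, the determinant of a weighted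
geometric mean is largest when det M and det N are, so everything reduces to
maximum determinant completions.

Such a completion exists: subtracting a small multiple of the identity keeps the
partial matrix positive semidefinite on every clique, so completability yields a
positive definite completion; and the positive semidefinite completions form a
compact set, because the diagonal is prescribed and bounds all the entries. It
is unique: if M <> N have the same determinant and the l_i are the eigenvalues
of M^(-1/2) N M^(-1/2), then prod l_i = 1 and the determinant of the midpoint is
det M * prod ((1 + l_i) / 2), which exceeds det M by AM-GM. *)

(** * Adjoints, definite and semidefinite matrices, and their spectral decomposition *)

Section MatrixPower.
Variable R : realType.
Local Notation C := (complex R).

Lemma ctrE m k (A : 'M[C]_(m, k)) i j : ctr A i j = Num.conj (A j i).
Proof. by rewrite /ctr !mxE. Qed.

Lemma ctrM m k l (A : 'M[C]_(m, k)) (B : 'M[C]_(k, l)) :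
  ctr (A *m B) = ctr B *m ctr A.
Proof. by rewrite /ctr trmx_mul map_mxM. Qed.

Lemma ctrK m k (A : 'M[C]_(m, k)) : ctr (ctr A) = A.
Proof. by apply/matrixP => i j; rewrite !ctrE conjCK. Qed.

Lemma ctrD m k (A B : 'M[C]_(m, k)) : ctr (A + B) = ctr A + ctr B.
Proof. by apply/matrixP => i j; rewrite ctrE !mxE rmorphD. Qed.

Lemma ctr_real_scalar k (a : R) : ctr (a%:C%C%:M) = a%:C%C%:M :> 'M[C]_k.
Proof.
apply/matrixP => i j; rewrite ctrE !mxE rmorphMn eq_sym; congr (_ *+ _).
by apply: conj_Creal; apply/complex_realP; exists a.
Qed.

Lemma qform_diag k (d : 'rV[C]_k) (x : 'cV[C]_k) :
  (ctr x *m diag_mx d *m x) 0 0 = \sum_i d 0 i * `|x i 0| ^+ 2.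
Proof.
rewrite mul_mx_diag mxE; apply: eq_bigr => i _.
by rewrite mxE ctrE normCKC mulrC mulrA mulrC (mulrC (x i 0)).
Qed.

Lemma hermitian_diag k (d : 'rV[C]_k) :
  (forall i, 0 <= d 0 i) -> hermitian (diag_mx d).
Proof.
move=> d0; apply/matrixP => i j; rewrite ctrE !mxE rmorphMn eq_sym.
case: eqVneq => [->|//]; rewrite mulr1n.
by apply: conj_Creal; exact: ger0_real.
Qed.

Lemma pdmx_diag k (d : 'rV[C]_k) : (forall i, 0 < d 0 i) -> pdmx (diag_mx d).
Proof.
move=> d0; split; first by apply: hermitian_diag => i; exact: ltW.
move=> x x0; rewrite qform_diag.
have [i xi0] : exists i, x i 0 != 0.
  apply/existsP; apply: contraNT x0; rewrite negb_exists => /forallP x0.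
  by apply/eqP/matrixP => i j; rewrite ord1 mxE; apply/eqP; have := x0 i; rewrite negbK.
rewrite (bigD1 i) //= ltr_pwDl //.
  by rewrite mulr_gt0 // exprn_gt0 // normr_gt0.
by apply: sumr_ge0 => j _; rewrite mulr_ge0 ?exprn_ge0 // ltW.
Qed.

Lemma psdmx_diag k (d : 'rV[C]_k) : (forall i, 0 <= d 0 i) -> psdmx (diag_mx d).
Proof.
move=> d0; split; first exact: hermitian_diag.
move=> x; rewrite qform_diag.
by apply: sumr_ge0 => j _; rewrite mulr_ge0 ?exprn_ge0.
Qed.

Lemma hermitian_congr k l (A : 'M[C]_k) (S : 'M[C]_(k, l)) :
  hermitian A -> hermitian (ctr S *m A *m S).
Proof. by rewrite /hermitian => hA; rewrite !ctrM ctrK hA mulmxA. Qed.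

Lemma psdmx_congr k l (A : 'M[C]_k) (S : 'M[C]_(k, l)) :
  psdmx A -> psdmx (ctr S *m A *m S).
Proof.
case=> hA pA; split; first exact: hermitian_congr.
by move=> x; have := pA (S *m x); rewrite ctrM !mulmxA.
Qed.

Lemma pdmx_congr k (A S : 'M[C]_k) :
  pdmx A -> S \in unitmx -> pdmx (ctr S *m A *m S).
Proof.
case=> hA pA uS; split; first exact: hermitian_congr.
move=> x x0; have := pA (S *m x); rewrite ctrM !mulmxA; apply.
by apply: contraNneq x0 => Sx; rewrite -(mulKmx uS x) Sx mulmx0.
Qed.

Lemma pdmx_psd k (A : 'M[C]_k) : pdmx A -> psdmx A.
Proof.
case=> hA pA; split=> // x; have [->|/pA/ltW//] := eqVneq x 0.
by rewrite mulmx0 mxE.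
Qed.

Lemma hermitianD k (A B : 'M[C]_k) :
  hermitian A -> hermitian B -> hermitian (A + B).
Proof. by rewrite /hermitian ctrD => -> ->. Qed.

Lemma qformD k (A B : 'M[C]_k) (x : 'cV[C]_k) :
  (ctr x *m (A + B) *m x) 0 0 = (ctr x *m A *m x) 0 0 + (ctr x *m B *m x) 0 0.
Proof. by rewrite mulmxDr mulmxDl mxE. Qed.

Lemma psdmxD k (A B : 'M[C]_k) : psdmx A -> psdmx B -> psdmx (A + B).
Proof.
move=> [hA pA] [hB pB]; split; first exact: hermitianD.
by move=> x; rewrite qformD addr_ge0.
Qed.

Lemma pdmxD k (A B : 'M[C]_k) : psdmx A -> pdmx B -> pdmx (A + B).
Proof.
move=> [hA pA] [hB pB]; split; first exact: hermitianD.
by move=> x x0; rewrite qformD ltr_wpDl ?pB.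
Qed.

Lemma pdmx_scalar k (a : R) : 0 < a -> pdmx (a%:C%C%:M : 'M[C]_k).
Proof.
by move=> a0; rewrite -diag_const_mx; apply: pdmx_diag => i; rewrite mxE ltcR.
Qed.

Lemma psdmx_scalar k (a : R) : 0 <= a -> psdmx (a%:C%C%:M : 'M[C]_k).
Proof.
by move=> a0; rewrite -diag_const_mx; apply: psdmx_diag => i; rewrite mxE lecR.
Qed.

Lemma spectralmx_ctrl k (A : 'M[C]_k) : ctr (spectralmx A) *m spectralmx A = 1%:M.
Proof.
have := mulVmx (spectral_unit A).
by rewrite invmx_unitary // spectral_unitarymx.
Qed.

Lemma spectralmx_ctrr k (A : 'M[C]_k) : spectralmx A *m ctr (spectralmx A) = 1%:M.
Proof.
have := mulmxV (spectral_unit A).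
by rewrite invmx_unitary // spectral_unitarymx.
Qed.

Lemma invmx_spectral k (A : 'M[C]_k) : invmx (spectralmx A) = ctr (spectralmx A).
Proof. by rewrite invmx_unitary // spectral_unitarymx. Qed.

Lemma hermitian_spectralE k (A : 'M[C]_k) : hermitian A ->
  A = ctr (spectralmx A) *m diag_mx (spectral_diag A) *m spectralmx A.
Proof.
move=> hA; rewrite -invmx_spectral; apply/orthomx_spectralP/normalmxP.
by have -> : map_mx Num.conj A^T = A by [].
Qed.

(** The adjoint of the i-th row of the unitary matrix [P] is an eigenvector, and [P *m A *m ctr P]
    is diagonal. Positivity of the quadratic form thus passes to the eigenvalues. *)
Lemma spectral_diagE k (A : 'M[C]_k) i : hermitian A ->
  spectral_diag A 0 i =
  (ctr (ctr (row i (spectralmx A))) *m A *m ctr (row i (spectralmx A))) 0 0.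
Proof.
move=> hA; set P := spectralmx A; have PP : P *m ctr P = 1%:M.
  exact: spectralmx_ctrr.
have E : P *m A *m ctr P = diag_mx (spectral_diag A).
  by rewrite {1}(hermitian_spectralE hA) -/P !mulmxA PP mul1mx -mulmxA PP mulmx1.
have -> : ctr (row i P) = col i (ctr P) by apply/matrixP => a b; rewrite !mxE.
have -> : ctr (col i (ctr P)) = row i P.
  by apply/matrixP => a b; rewrite ctrE !mxE conjCK.
transitivity ((P *m A *m ctr P) i i); first by rewrite E mxE eqxx.
by rewrite -row_mul mxE [RHS]mxE; apply: eq_bigr => j _; rewrite [row _ _ _ _]mxE [col _ _ _ _]mxE.
Qed.

Lemma row_spectralmx_neq0 k (A : 'M[C]_k) i : ctr (row i (spectralmx A)) != 0.
Proof.
apply/negP => /eqP r0; have /matrixP/(_ i i) := spectralmx_ctrr A.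
rewrite !mxE eqxx => /eqP; rewrite eq_sym big1 ?oner_eq0 // => j _.
by move/matrixP: r0 => /(_ j 0); rewrite ctrE !mxE => ->; rewrite mulr0.
Qed.

Lemma spectral_diag_gt0 k (A : 'M[C]_k) i : pdmx A -> 0 < spectral_diag A 0 i.
Proof. by case=> hA pA; rewrite spectral_diagE // pA // row_spectralmx_neq0. Qed.

Lemma spectral_diag_ge0 k (A : 'M[C]_k) i : psdmx A -> 0 <= spectral_diag A 0 i.
Proof. by case=> hA pA; rewrite spectral_diagE. Qed.

Lemma det_unitary_congr k (A P : 'M[C]_k) : ctr P *m P = 1%:M ->
  \det (ctr P *m A *m P) = \det A.
Proof.
move=> PP; by rewrite !det_mulmx mulrAC -det_mulmx PP det1 mul1r.
Qed.

Lemma det_hermitian k (A : 'M[C]_k) : hermitian A ->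
  \det A = \prod_i spectral_diag A 0 i.
Proof.
move=> hA; rewrite {1}(hermitian_spectralE hA) det_unitary_congr ?det_diag //.
exact: spectralmx_ctrl.
Qed.

Lemma det_pdmx_gt0 k (A : 'M[C]_k) : pdmx A -> 0 < \det A.
Proof.
move=> pA; rewrite (det_hermitian (proj1 pA)).
by apply: prodr_gt0 => i _; exact: spectral_diag_gt0.
Qed.

Lemma pdmx_unit k (A : 'M[C]_k) : pdmx A -> A \in unitmx.
Proof. by move=> /det_pdmx_gt0 dA; rewrite unitmxE unitfE gt_eqF. Qed.

(** The determinant is the product of the nonnegative eigenvalues, so if it is nonzero none of them
    vanishes. This later shows that a maximizer found among semidefinite completions is definite. *)
Lemma psdmx_det_pd k (A : 'M[C]_k) : psdmx A -> \det A != 0 -> pdmx A.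
Proof.
move=> pA; rewrite (det_hermitian (proj1 pA)) => /prodf_neq0 d0.
rewrite (hermitian_spectralE (proj1 pA)).
apply: pdmx_congr; last exact: spectral_unit.
by apply: pdmx_diag => i; rewrite lt0r d0 // spectral_diag_ge0.
Qed.

Lemma psd_sub_scalar k (A : 'M[C]_k) : pdmx A ->
  exists2 e : R, 0 < e & psdmx (A - e%:C%C%:M).
Proof.
move=> pA; pose d := spectral_diag A.
have dE i : d 0 i = (complex.Re (d 0 i))%:C%C.
  by rewrite RRe_real // gtr0_real // spectral_diag_gt0.
have dgt i : 0 < complex.Re (d 0 i).
  by rewrite -ltcR -dE spectral_diag_gt0.
(* The smallest eigenvalue, capped at the default value 1, which keeps it positive even when [k] is
   0. *)
exists (\big[Order.min/1]_i complex.Re (d 0 i)).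
  by elim/big_ind: _ => // x y x0 y0; rewrite lt_min x0.
set e := \big[_/_]_i _.
have -> : A - e%:C%C%:M = ctr (spectralmx A) *m
    diag_mx (\row_i (complex.Re (d 0 i) - e)%:C%C) *m spectralmx A.
  have -> : diag_mx (\row_i (complex.Re (d 0 i) - e)%:C%C) = diag_mx d - e%:C%C%:M.
    apply/matrixP => i j; rewrite !mxE rmorphB /= -dE.
    by rewrite mulrnBl.
  rewrite mulmxBr mulmxBl -hermitian_spectralE; last by case: pA.
  by rewrite mul_mx_scalar -scalemxAl spectralmx_ctrl scalemx1.
apply: psdmx_congr; apply: psdmx_diag => i; rewrite mxE lecR subr_ge0.
exact: bigmin_le_cond.
Qed.

(** * Real powers of positive definite matrices *)

Section Power.
Variable n : nat.
Implicit Types X M N : 'M[C]_n.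

Lemma Re_gt0 (z : C) : 0 < z -> 0 < complex.Re z.
Proof. by rewrite ltcE => /andP[]. Qed.

Lemma Re_ge0K (z : C) : 0 <= z -> (complex.Re z)%:C%C = z.
Proof. by move=> z0; rewrite RRe_real // ger0_real. Qed.

Lemma powm_ctrE X r : powm X r = ctr (spectralmx X) *m
  diag_mx (\row_i ((complex.Re (spectral_diag X 0 i)) `^ r)%:C%C) *m spectralmx X.
Proof. by rewrite /powm invmx_spectral. Qed.

Lemma pdmx_powm X r : pdmx X -> pdmx (powm X r).
Proof.
move=> pX; rewrite powm_ctrE; apply: pdmx_congr (spectral_unit X).
by apply: pdmx_diag => i; rewrite mxE ltcR powR_gt0 // Re_gt0 // spectral_diag_gt0.
Qed.

(** Both powers are diagonal in the same eigenbasis, so the inner unitary factors cancel, and real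
    exponents add because the eigenvalues are positive. *)
Lemma powmD X r s : pdmx X -> powm X (r + s) = powm X r *m powm X s.
Proof.
move=> pX; rewrite !powm_ctrE !mulmxA.
rewrite -(mulmxA (_ *m diag_mx _) (spectralmx X)) spectralmx_ctrr mulmx1.
rewrite -(mulmxA _ (diag_mx _) (diag_mx _)) mulmx_diag; congr (_ *m diag_mx _ *m _).
apply/rowP => i; rewrite !mxE -rmorphM -powRD //.
by rewrite (gt_eqF (Re_gt0 _)) ?implybT // spectral_diag_gt0.
Qed.

Lemma powm0 X : powm X 0 = 1%:M.
Proof.
rewrite powm_ctrE (_ : \row_i _ = const_mx 1).
  by rewrite diag_const_mx mulmx1 spectralmx_ctrl.
by apply/rowP => i; rewrite !mxE powRr0.
Qed.

Lemma powm1 X : pdmx X -> powm X 1 = X.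
Proof.
move=> pX; rewrite powm_ctrE [RHS]hermitian_spectralE; last by case: pX.
congr (_ *m diag_mx _ *m _); apply/rowP => i; have d0 := spectral_diag_gt0 i pX.
by rewrite mxE powRr1 ?Re_ge0K ?ltW // Re_gt0.
Qed.

Lemma det_powm X r : pdmx X -> \det (powm X r) = (complex.Re (\det X) `^ r)%:C%C.
Proof.
move=> pX; rewrite powm_ctrE det_unitary_congr ?spectralmx_ctrl // det_diag.
rewrite (det_hermitian (proj1 pX)).
pose d i := complex.Re (spectral_diag X 0 i).
have d0 i : 0 < d i by rewrite Re_gt0 // spectral_diag_gt0.
rewrite [in RHS](eq_bigr (fun i => (d i)%:C%C)); last first.
  by move=> i _; rewrite Re_ge0K // ltW // spectral_diag_gt0.
under eq_bigr do rewrite mxE -/(d _).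
rewrite -!rmorph_prod /=; congr (_%:C%C).
(* The induction carries nonnegativity of the partial products along, since [powRM] requires it of
   both factors. *)
suff [_ //] : 0 <= \prod_i d i /\ \prod_i d i `^ r = (\prod_i d i) `^ r.
elim/big_ind2: _ => [|x x' y y' [x0 ->] [y0 ->]|i _]; rewrite ?powR1 ?ler01 //.
  by rewrite mulr_ge0 // powRM.
by rewrite ltW.
Qed.
End Power.
End MatrixPower.

(** * Determinants of geometric means, and strict growth of the determinant at a midpoint *)

Section GeometricMean.
Variables (R : realType) (n : nat).
Local Notation C := (complex R).
Implicit Types M N : 'M[C]_n.

Lemma powmNK M r : pdmx M -> powm M r *m powm M (- r) = 1%:M.
Proof. by move=> pM; rewrite -powmD // subrr powm0. Qed.

Lemma powmKN M r : pdmx M -> powm M (- r) *m powm M r = 1%:M.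
Proof. by move=> pM; rewrite -powmD // addNr powm0. Qed.

Lemma powm_half_sqr M : pdmx M -> powm M 2^-1 *m powm M 2^-1 = M.
Proof. by move=> pM; rewrite -powmD // (_ : 2^-1 + 2^-1 = 1) ?powm1 //; field. Qed.

Lemma pdmx_normalized M N r : pdmx M -> pdmx N ->
  pdmx (powm M r *m N *m powm M r).
Proof.
move=> pM pN; have pS := pdmx_powm r pM.
by rewrite -{1}(proj1 pS); apply: pdmx_congr (pdmx_unit pS).
Qed.

Lemma gmean0 M N : pdmx M -> gmean M N 0 = M.
Proof. by move=> pM; rewrite /gmean powm0 mulmx1 powm_half_sqr. Qed.

Lemma gmean1 M N : pdmx M -> pdmx N -> gmean M N 1 = N.
Proof.
move=> pM pN; rewrite /gmean powm1; last exact: pdmx_normalized.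
have := powmNK 2^-1 pM; have := powmKN 2^-1 pM.
move: (powm M 2^-1) (powm M (- 2^-1)) => T S ST TS.
by rewrite !mulmxA TS mul1mx -mulmxA ST mulmx1.
Qed.

Lemma det_mulmx3 (A B D : 'M[C]_n) :
  \det (A *m B *m D) = \det A * \det B * \det D.
Proof. by rewrite !det_mulmx. Qed.

(** The determinant is multiplicative and commutes with real powers. The outer factors contribute
    the exponent 1/2 of det M twice, the inner ones -t/2 twice, which adds up to 1 - t. *)
Lemma det_gmean M N t : pdmx M -> pdmx N -> \det (gmean M N t) =
  (complex.Re (\det M) `^ (1 - t) * complex.Re (\det N) `^ t)%:C%C.
Proof.
move=> pM pN; have pY := pdmx_normalized (- 2^-1) pM pN.
have dY := det_mulmx3 (powm M (- 2^-1)) N (powm M (- 2^-1)).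
have dZ := det_powm t pY; have dT := det_powm 2^-1 pM.
have dS := det_powm (- 2^-1) pM; rewrite /gmean; move: {pY} dZ dS dT dY.
move: (powm (_ *m N *m _) t) => Z; move: (powm M 2^-1) (powm M (- 2^-1)) => T S.
move=> dZ dS dT dY; rewrite det_mulmx3 dZ dY dS dT.
have a0 := Re_gt0 (det_pdmx_gt0 pM); have b0 := Re_gt0 (det_pdmx_gt0 pN).
rewrite -(Re_ge0K (ltW (det_pdmx_gt0 pN))) -!rmorphM /=.
set a := complex.Re (\det M) in a0 *; set b := complex.Re (\det N) in b0 *.
congr (_%:C%C); rewrite !powRM ?mulr_ge0 ?powR_ge0 ?ltW // -!powRrM.
have aD r s : a `^ r * a `^ s = a `^ (r + s).
  by rewrite powRD // (gt_eqF a0) implybT.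
rewrite (_ : 1 - t = 2^-1 + - 2^-1 * t + - 2^-1 * t + 2^-1); last by field.
by rewrite -!aD; ring.
Qed.

(** AM-GM is applied to each factor with 1: ((1 + x) / 2)^2 - x = ((1 - x) / 2)^2 is nonnegative,
    and positive unless x = 1. Comparing the square of the product with the product of the [e i],
    which is 1, avoids square roots. *)
Lemma one_lt_prod_mean (I : finType) (e : I -> R) i : (forall i, 0 < e i) ->
  \prod_i e i = 1 -> e i != 1 -> 1 < \prod_i ((1 + e i) / 2).
Proof.
move=> e0 e1 ei1; set p := \prod_i _.
have p0 : 0 <= p by apply: prodr_ge0 => j _; rewrite divr_ge0 // addr_ge0 // ltW.
suff : 1 < p ^+ 2 by rewrite -[X in X < _](expr1n _ 2) ltr_pXn2r ?nnegrE.
rewrite -e1 -prodrXl (bigD1 i) //= [ltRHS](bigD1 i) //=.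
have step j : ((1 + e j) / 2) ^+ 2 - e j = ((1 - e j) / 2) ^+ 2 by field.
apply: (@lt_le_trans _ _ (((1 + e i) / 2) ^+ 2 * \prod_(j | j != i) e j)).
  rewrite ltr_pM2r; last by apply: prodr_gt0.
  rewrite -subr_gt0 step exprn_even_gt0 //=.
  by rewrite mulf_neq0 ?invr_eq0 ?pnatr_eq0 // subr_eq0 eq_sym.
apply: ler_wpM2l; first exact: sqr_ge0.
by apply: ler_prod => j _; rewrite ltW //= -subr_ge0 step sqr_ge0.
Qed.

Lemma det_midpoint_gt M N : pdmx M -> pdmx N -> \det M = \det N -> M != N ->
  \det M < \det (2^-1 *: (M + N)).
Proof.
move=> pM pN MN neqMN; 
have := powmNK 2^-1 pM; have := powmKN 2^-1 pM; have := powm_half_sqr pM.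
have := pdmx_normalized (- 2^-1) pM pN.
move: (powm M 2^-1) (powm M (- 2^-1)) => T S; set X := S *m N *m S.
move=> pX TT ST TS.
(* With [T] the square root of [M], both matrices are congruent through [T] to simpler ones: [M] to
   the identity and [N] to [X]. *)
have NE : N = T *m X *m T by rewrite /X !mulmxA TS mul1mx -mulmxA ST mulmx1.
clearbody X; pose e i := complex.Re (spectral_diag X 0 i).
have e0 i : 0 < e i by exact/Re_gt0/spectral_diag_gt0.
have eE i : spectral_diag X 0 i = (e i)%:C%C.
  by rewrite Re_ge0K // ltW // spectral_diag_gt0.
have XE := hermitian_spectralE (proj1 pX).
have dM := det_pdmx_gt0 pM.
have dX : \det X = 1.
  have : \det M * \det X = \det M * 1.
    by rewrite mulr1 [RHS]MN NE !det_mulmx mulrAC -TT det_mulmx.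
  by apply: mulfI; rewrite gt_eqF.
(* If every eigenvalue were 1, then [X] would be the identity and [N] would equal [T *m T], that is
   [M]. *)
have [i ei1] : exists i, e i != 1.
  apply/existsP; apply: contraNT neqMN; rewrite negb_exists => /forallP e1.
  suff X1 : X = 1%:M by rewrite NE X1 mulmx1 TT.
  rewrite XE (_ : spectral_diag X = const_mx 1).
    by rewrite diag_const_mx mulmx1 spectralmx_ctrl.
  by apply/rowP => i; rewrite eE mxE; have := e1 i; rewrite negbK => /eqP ->.
(* The midpoint is T ((1 + X) / 2) T, and the middle factor is diagonal in the eigenbasis of [X]. *)
have midE : 2^-1 *: (M + N) = T *m (ctr (spectralmx X) *m
    diag_mx (\row_i ((1 + e i) / 2)%:C%C) *m spectralmx X) *m T.
  have -> : diag_mx (\row_i ((1 + e i) / 2)%:C%C) =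
      2^-1 *: (1%:M + diag_mx (spectral_diag X)).
    apply/matrixP => a b; rewrite !mxE eE -mulrnDl mulrnAr; congr (_ *+ _).
    by rewrite rmorphM rmorphD /= fmorphV rmorph_nat mulrC.
  rewrite -scalemxAr mulmxDr mulmx1 -scalemxAl mulmxDl -XE spectralmx_ctrl.
  by rewrite -scalemxAr -scalemxAl mulmxDr mulmx1 mulmxDl TT -NE.
rewrite midE det_mulmx3 mulrAC -det_mulmx TT.
rewrite det_unitary_congr ?spectralmx_ctrl // det_diag.
rewrite ltr_pMr //; under eq_bigr do rewrite mxE.
rewrite -rmorph_prod /= -[1]/(1%:C%C) ltcR.
apply: one_lt_prod_mean ei1 => //; apply: complexI.
rewrite rmorph_prod /= -[RHS]dX det_hermitian; last by case: pX.
by apply: eq_bigr => j _.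
Qed.

Lemma pdmxZ (c : C) M : 0 < c -> pdmx M -> pdmx (c *: M).
Proof.
move=> c0 [hM pM]; split.
  apply/matrixP => i j; rewrite ctrE !mxE rmorphM /= -{2}hM ctrE; congr (_ * _).
  by apply: conj_Creal; exact: gtr0_real.
by move=> x x0; rewrite -scalemxAr -scalemxAl mxE mulr_gt0 // pM.
Qed.

(** The midpoint of two positive definite completions is again one, so two distinct maximizers would
    be beaten by their midpoint. *)
Lemma maxdet_completion_uniq (G : rel 'I_n) (A M N : 'M[C]_n) :
  maxdet_completion G A M -> maxdet_completion G A N -> M = N.
Proof.
move=> [cM maxM] [cN maxN]; apply/eqP; apply: contraT => neqMN.
have [[eM pM] [eN pN]] := (cM, cN).
have dMN : \det M = \det N by apply/le_anti; rewrite maxM // maxN.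
have := det_midpoint_gt pM pN dMN neqMN.
rewrite le_gtF //; apply: maxM; split.
  by move=> i j Gij; rewrite !mxE eM // eN //; field.
by apply: pdmxZ; [rewrite invr_gt0 | apply: pdmxD => //; exact: pdmx_psd].
Qed.

End GeometricMean.

(** * Continuity of complex-valued functions and closed sets defined by them *)

Section ComplexContinuity.
Local Open Scope classical_set_scope.
Variables (R : realType) (T : topologicalType).
Local Notation C := (complex R).
Implicit Types f g : T -> C.

(** Continuity is expressed through the two real coordinates, so that closed sets and extreme values
    are handled with real-valued functions. *)
Definition continuousC f :=
  continuous (fun x => complex.Re (f x)) /\ continuous (fun x => complex.Im (f x)).

Lemma continuousC_cst (c : C) : continuousC (fun _ => c).
Proof. by split=> x; exact: cvg_cst. Qed.

Lemma continuousCD f g :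
  continuousC f -> continuousC g -> continuousC (fun x => f x + g x).
Proof.
move=> [rf jf] [rg jg]; split.
  rewrite (_ : (fun x => _) = fun x => complex.Re (f x) + complex.Re (g x)).
    by move=> x; apply: cvgD; [exact: rf|exact: rg].
  by apply/funext => x; rewrite raddfD.
rewrite (_ : (fun x => _) = fun x => complex.Im (f x) + complex.Im (g x)).
  by move=> x; apply: cvgD; [exact: jf|exact: jg].
by apply/funext => x; rewrite raddfD.
Qed.

Lemma continuousCM f g :
  continuousC f -> continuousC g -> continuousC (fun x => f x * g x).
Proof.
move=> [rf jf] [rg jg]; split.
  rewrite (_ : (fun x => _) = fun x => complex.Re (f x) * complex.Re (g x) -
      complex.Im (f x) * complex.Im (g x)).
    move=> x; apply: cvgB; apply: cvgM;
      [exact: rf|exact: rg|exact: jf|exact: jg].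
  by apply/funext => x; case: (f x) (g x) => [a b] [c d].
rewrite (_ : (fun x => _) = fun x => complex.Re (f x) * complex.Im (g x) +
    complex.Im (f x) * complex.Re (g x)).
  move=> x; apply: cvgD; apply: cvgM;
    [exact: rf|exact: jg|exact: jf|exact: rg].
by apply/funext => x; case: (f x) (g x) => [a b] [c d].
Qed.

Lemma continuousC_conj f : continuousC f -> continuousC (fun x => Num.conj (f x)).
Proof.
move=> [rf jf]; split.
  rewrite (_ : (fun x => _) = fun x => complex.Re (f x)) //.
  by apply/funext => x; case: (f x).
rewrite (_ : (fun x => _) = fun x => - complex.Im (f x)).
  by move=> x; apply: cvgN; exact: jf.
by apply/funext => x; case: (f x).
Qed.

Lemma continuousC_sum (I : Type) (r : seq I) (P : pred I) (F : I -> T -> C) :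
  (forall i, continuousC (F i)) -> continuousC (fun x => \sum_(i <- r | P i) F i x).
Proof.
move=> cF; elim: r => [|i r IHr].
  by under eq_fun do rewrite big_nil; exact: continuousC_cst.
under eq_fun do rewrite big_cons.
by case: (P i) => //; exact: continuousCD.
Qed.

Lemma continuousC_prod (I : Type) (r : seq I) (P : pred I) (F : I -> T -> C) :
  (forall i, continuousC (F i)) -> continuousC (fun x => \prod_(i <- r | P i) F i x).
Proof.
move=> cF; elim: r => [|i r IHr].
  by under eq_fun do rewrite big_nil; exact: continuousC_cst.
under eq_fun do rewrite big_cons.
by case: (P i) => //; exact: continuousCM.
Qed.

(** By the Leibniz formula the determinant is a sum of products of entries. *)
Lemma continuousC_det n (M : T -> 'M[C]_n) :
  (forall i j, continuousC (fun x => M x i j)) -> continuousC (fun x => \det (M x)).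
Proof.
move=> cM; apply: continuousC_sum => s; apply: continuousCM.
  exact: continuousC_cst.
exact: continuousC_prod.
Qed.

Lemma continuousC_qform n (M : T -> 'M[C]_n) (v : 'cV[C]_n) :
  (forall i j, continuousC (fun x => M x i j)) ->
  continuousC (fun x => (ctr v *m M x *m v) 0 0).
Proof.
move=> cM; under eq_fun do rewrite mxE.
apply: continuousC_sum => j; apply: continuousCM; last exact: continuousC_cst.
under eq_fun do rewrite mxE.
by apply: continuousC_sum => i; apply: continuousCM; first exact: continuousC_cst.
Qed.

Lemma closed_continuousC_eq f g : continuousC f -> continuousC g ->
  closed [set x | f x = g x].
Proof.
(* The difference is written with the constant factor -1, so that stability under sums and products
   suffices. *)
move=> cf cg; have [rd jd] : continuousC (fun x => f x + (-1) * g x).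
  by apply: continuousCD => //; apply: continuousCM => //; exact: continuousC_cst.
rewrite (_ : [set x | _] =
  (fun x => complex.Re (f x + (-1) * g x)) @^-1` [set y | y = 0] `&`
  (fun x => complex.Im (f x + (-1) * g x)) @^-1` [set y | y = 0]).
  by apply: closedI; [apply: (proj1 (continuous_closedP _) rd)
                     |apply: (proj1 (continuous_closedP _) jd)]; exact: closed_eq.
apply/seteqP; split=> x /=; rewrite mulN1r.
  by move=> ->; rewrite subrr.
by move=> [r0 j0]; apply/eqP; rewrite -subr_eq0 eq_complex r0 j0 !eqxx.
Qed.

(** In the order on complex numbers, being nonnegative means having zero imaginary part and
    nonnegative real part; both conditions are closed. *)
Lemma closed_continuousC_ge0 f : continuousC f -> closed [set x | 0 <= f x].
Proof.
move=> [rf jf]; rewrite (_ : [set x | _] =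
  (fun x => complex.Re (f x)) @^-1` [set y | 0 <= y] `&`
  (fun x => complex.Im (f x)) @^-1` [set y | y = 0]).
  apply: closedI; first by apply: (proj1 (continuous_closedP _) rf); exact: closed_ge.
  by apply: (proj1 (continuous_closedP _) jf); exact: closed_eq.
apply/seteqP; split=> x /=; rewrite lecE /=; first by move=> /andP[/eqP -> ->].
by move=> [-> ->]; rewrite eqxx.
Qed.

End ComplexContinuity.

(** * Existence of maximum determinant completions *)

Section MaxDet.
Local Open Scope classical_set_scope.
Variables (R : realType) (n : nat).
Local Notation C := (complex R).
Implicit Types (G : rel 'I_n) (A M : 'M[C]_n).

Lemma princ_subB A (a : C) (S : {set 'I_n}) :
  princ_sub (A - a%:M) S = princ_sub A S - a%:M.
Proof.
by apply/matrixP => i j; rewrite !mxE (inj_eq enum_val_inj).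
Qed.

Lemma pd_completion_exists G A : completable R G ->
  partial_pd G A -> exists M, pd_completion G A M.
Proof.
move=> compG [hA pA].
(* Each clique gets its own admissible shift; a set that is not a clique gets the harmless value
   1. *)
have /fin_all_exists[e eP] : forall S : {set 'I_n}, exists e : R, 0 < e /\
    (clique G S -> psdmx (princ_sub A S - e%:C%C%:M)).
  move=> S; have [/pA/psd_sub_scalar[e e0 pe]|nS] := pselect (clique G S).
    by exists e.
  by exists 1.
pose d := \big[Order.min/1]_(S : {set 'I_n}) e S.
have d0 : 0 < d.
  by rewrite /d; elim/big_ind: _ => [||S _];
    [exact: ltr01|move=> x y x0 y0; rewrite lt_min x0|case: (eP S)].
(* The common shift [d] is at most every [e S], so the lowered matrix stays semidefinite on each
   clique and completability applies. Adding [d] times the identity back restores the prescribed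
   entries and makes the completion definite. *)
have [M [cM pM]] : exists M, completion G (A - d%:C%C%:M) M /\ psdmx M.
  apply: compG; split.
    move=> i j Gij; have /matrixP/(_ i j) := ctr_real_scalar n d.
    by rewrite ctrE => dE; rewrite !mxE in dE *; rewrite rmorphB /= hA // dE.
  move=> S cS; rewrite princ_subB.
  have -> : princ_sub A S - d%:C%C%:M =
      (princ_sub A S - (e S)%:C%C%:M) + (e S - d)%:C%C%:M.
    by rewrite rmorphB /= raddfB /= addrA subrK.
  apply: psdmxD; first by case: (eP S) => _; exact.
  by apply: psdmx_scalar; rewrite subr_ge0; exact: bigmin_le_cond.
exists (M + d%:C%C%:M); split; last by apply: pdmxD => //; exact: pdmx_scalar.
by move=> i j Gij; rewrite mxE cM // !mxE subrK.
Qed.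

Lemma qform_delta2 M i j (c : C) :
  let x : 'cV[C]_n := delta_mx i 0 + c *: delta_mx j 0 in
  (ctr x *m M *m x) 0 0 =
  M i i + c * M i j + Num.conj c * M j i + Num.conj c * c * M j j.
Proof.
rewrite /=; have ctrd k : ctr (delta_mx k 0 : 'cV[C]_n) = delta_mx 0 k.
  by apply/matrixP => a b; rewrite ctrE !mxE andbC; case: (_ && _); rewrite ?rmorph1 ?rmorph0.
have ctrZ (x : 'cV[C]_n) : ctr (c *: x) = Num.conj c *: ctr x.
  by apply/matrixP => a b; rewrite !mxE rmorphM.
have dd k l : (delta_mx 0 k *m M *m delta_mx l 0 : 'M[C]_1) 0 0 = M k l.
  by rewrite -rowE -colE !mxE.
rewrite ctrD ctrZ !ctrd mulmxDl mulmxDr !mulmxDl.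
have addE (X Y : 'M[C]_1) : (X + Y) 0 0 = X 0 0 + Y 0 0 by rewrite mxE.
have scaleE a (X : 'M[C]_1) : (a *: X) 0 0 = a * X 0 0 by rewrite mxE.
by rewrite -!scalemxAl -!scalemxAr !addE !scaleE !dd; ring.
Qed.

(** Nonnegativity of the form at e_i + c e_j, for c a fourth root of unity, bounds twice the real or
    imaginary part of [M i j] by the sum of two diagonal entries, hence by twice the trace. *)
Lemma psdmx_entry_bound M i j : psdmx M ->
  `|complex.Re (M i j)| <= \sum_k complex.Re (M k k) /\
  `|complex.Im (M i j)| <= \sum_k complex.Re (M k k).
Proof.
move=> [hM pM].
have Mji : M j i = Num.conj (M i j) by rewrite -{1}hM ctrE.
have key c : 0 <= M i i + c * M i j + Num.conj c * M j i + Num.conj c * c * M j j.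
  by rewrite -qform_delta2.
have diag k : 0 <= complex.Re (M k k).
  have := pM (delta_mx k 0); have := qform_delta2 M k k 0.
  rewrite scale0r addr0 => ->; rewrite !mul0r rmorph0 !mul0r !addr0.
  by rewrite lecE => /andP[].
have le_tr k : complex.Re (M k k) <= \sum_l complex.Re (M l l).
  by rewrite (bigD1 k) //= lerDl sumr_ge0.
have Re_le c : 0 <= complex.Re (M i i + c * M i j + Num.conj c * M j i + Num.conj c * c * M j j).
  by have := key c; rewrite lecE => /andP[].
(* The values 1 and -1 control the real part, the values i and -i the imaginary part. *)
have := (Re_le 1, Re_le (-1), Re_le (0 +i* 1)%C, Re_le (0 -i* 1)%C).
rewrite Mji; have := (le_tr i, le_tr j).
case: (M i j) (M i i) (M j j) => [a b] [ai bi] [aj bj] /=.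
move: (\sum_l _) => s.
rewrite !ler_norml => -[h1 h2] [[[h3 h4] h5] h6].
by split; apply/andP; split; lra.
Qed.

(** Matrices are parametrized by a finite product of real lines with the pointwise topology, where
    Tychonoff's theorem gives compact boxes. The boolean is [true] for imaginary parts. *)
Definition mx_of_coords (f : {ptws (bool * 'I_n * 'I_n) -> R}) : 'M[C]_n :=
  \matrix_(i, j) Complex (f (false, i, j)) (f (true, i, j)).

Definition coords_of_mx M : {ptws (bool * 'I_n * 'I_n) -> R} :=
  fun p => let: (b, i, j) := p in
    if b then complex.Im (M i j) else complex.Re (M i j).

Lemma coords_of_mxK M : mx_of_coords (coords_of_mx M) = M.
Proof. by apply/matrixP => i j; rewrite mxE /=; case: (M i j). Qed.

Lemma continuousC_mx_of_coords i j : continuousC (fun f => mx_of_coords f i j).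
Proof.
split.
  rewrite (_ : (fun f => _) = fun f : {ptws _ -> _} => f (false, i, j)).
    exact: (@proj_continuous _ (fun=> R) (false, i, j)).
  by apply/funext => f; rewrite mxE.
rewrite (_ : (fun f => _) = fun f : {ptws _ -> _} => f (true, i, j)).
  exact: (@proj_continuous _ (fun=> R) (true, i, j)).
by apply/funext => f; rewrite mxE.
Qed.

Lemma closed_psdmx_coords : closed [set f | psdmx (mx_of_coords f)].
Proof.
rewrite [X in closed X](_ : _ =
  (\bigcap_(i : 'I_n) \bigcap_(j : 'I_n) 
     [set f | Num.conj (mx_of_coords f j i) = mx_of_coords f i j]) `&`
  \bigcap_(v : 'cV[C]_n) [set f | 0 <= (ctr v *m mx_of_coords f *m v) 0 0]).
  apply: closedI.
    do 2 (apply: closed_bigI => ? _).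
    apply: closed_continuousC_eq; last exact: continuousC_mx_of_coords.
    exact/continuousC_conj/continuousC_mx_of_coords.
  apply: closed_bigI => v _; apply: closed_continuousC_ge0.
  by apply: continuousC_qform => i j; exact: continuousC_mx_of_coords.
apply/seteqP; split=> f /=.
  by move=> [hf pf]; split=> [i _ j _|v _] /=; [rewrite -ctrE hf|exact: pf].
move=> [hf pf]; split=> [|v]; last exact: pf.
by apply/matrixP => i j; rewrite ctrE; exact: hf.
Qed.

Lemma closed_completion_coords G A : closed [set f | completion G A (mx_of_coords f)].
Proof.
rewrite [X in closed X](_ : _ = \bigcap_(i : 'I_n) \bigcap_(j in [set j | G i j])
    [set f | mx_of_coords f i j = A i j]).
  do 2 (apply: closed_bigI => ? _).
  apply: closed_continuousC_eq; first exact: continuousC_mx_of_coords.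
  exact: continuousC_cst.
by apply/seteqP; split=> f cf i; [move=> _ j; exact: cf|move=> j; exact: cf].
Qed.

(** All loops are edges, so every completion has the trace fixed by [A]. The entry bound then places
    the closed set of semidefinite completions inside a product of segments. *)
Lemma compact_psd_completion_coords G A : reflexive G ->
  compact [set f | completion G A (mx_of_coords f) /\ psdmx (mx_of_coords f)].
Proof.
move=> Grefl; pose b := \sum_k complex.Re (A k k).
apply: (@subclosed_compact _ _
    [set f : {ptws (bool * 'I_n * 'I_n) -> R} | forall p, `[- b, b] (f p)]).
- by apply: closedI; [exact: closed_completion_coords|exact: closed_psdmx_coords].
- by apply: (@tychonoff _ (fun=> R) (fun=> `[- b, b])) => p; exact: segment_compact.
- move=> f [cf pf] [[c i] j] /=; rewrite in_itv /= -ler_norml.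
  have [] := psdmx_entry_bound i j pf; rewrite mxE /=.
  rewrite (_ : \sum_k _ = b); first by case: c.
  by apply: eq_bigr => k _; rewrite cf.
Qed.

Lemma maxdet_completion_exists G A : completable R G -> is_graph G ->
  partial_pd G A -> exists M, maxdet_completion G A M.
Proof.
move=> compG graphG pA; have [M0 [cM0 pM0]] := pd_completion_exists compG pA.
pose K := [set f | completion G A (mx_of_coords f) /\ psdmx (mx_of_coords f)].
have inK M : pd_completion G A M -> coords_of_mx M \in K.
  by move=> [cM pM]; rewrite inE /K /= coords_of_mxK; split=> //; exact: pdmx_psd.
(* The extreme value theorem is applied to the real part of the determinant over the semidefinite
   completions, which form a compact set. *)
have [] := @compact_EVT_max _ _ (fun f => complex.Re (\det (mx_of_coords f))) K.
- by exists (coords_of_mx M0); apply/set_mem/inK.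
- by apply: compact_psd_completion_coords; case: graphG.
- apply: continuous_subspaceT.
  by have [] := continuousC_det continuousC_mx_of_coords.
move=> f /set_mem[cf pf] fmax.
have Remax M : pd_completion G A M ->
    complex.Re (\det M) <= complex.Re (\det (mx_of_coords f)).
  by move=> /inK/fmax; rewrite coords_of_mxK.
(* The maximum is at least det [M0], which is positive, so the maximizer is nonsingular. *)
have pdf : pdmx (mx_of_coords f).
  apply: psdmx_det_pd => //; apply: contraTneq (Remax M0 _) => // ->.
  by rewrite -ltNge Re_gt0 // det_pdmx_gt0.
exists (mx_of_coords f); split=> [//|M cM].
(* Both determinants are positive, hence real, so comparing real parts gives the complex
   inequality. *)
rewrite -(Re_ge0K (ltW (det_pdmx_gt0 pdf))).
by rewrite -(Re_ge0K (ltW (det_pdmx_gt0 (proj2 cM)))) lecR Remax.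
Qed.

End MaxDet.

(** * Maximizing the determinant of the geometric mean *)

Section MaxGmean.
Variables (R : realType) (n : nat).
Local Notation C := (complex R).
Implicit Types (G F : rel 'I_n) (A B M N : 'M[C]_n).

Lemma maxdet_completion_Re_le G A Ah M : maxdet_completion G A Ah ->
  pd_completion G A M -> complex.Re (\det M) <= complex.Re (\det Ah).
Proof. by move=> [_ maxA] /maxA; rewrite lecE => /andP[]. Qed.

(** A completion whose determinant reaches that of [Ah] is itself a maximizer, so uniqueness
    identifies the two. *)
Lemma maxdet_completion_eq G A Ah M : maxdet_completion G A Ah ->
  pd_completion G A M -> complex.Re (\det Ah) <= complex.Re (\det M) -> M = Ah.
Proof.
move=> mA cM AM; apply: (@maxdet_completion_uniq _ _ G A) => //; split=> // N cN.
apply: le_trans (proj2 mA N cN) _; case: mA => -[_ pA] _; case: cM => _ pM.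
rewrite -(Re_ge0K (ltW (det_pdmx_gt0 pA))).
by rewrite -(Re_ge0K (ltW (det_pdmx_gt0 pM))) lecR.
Qed.

Lemma det_gmean_leE M N M' N' (t : R) :
    pdmx M -> pdmx N -> pdmx M' -> pdmx N' ->
  (\det (gmean M N t) <= \det (gmean M' N' t)) =
  (complex.Re (\det M) `^ (1 - t) * complex.Re (\det N) `^ t <=
   complex.Re (\det M') `^ (1 - t) * complex.Re (\det N') `^ t).
Proof.
move=> pM pN pM' pN'; have := det_gmean t pM pN; have := det_gmean t pM' pN'.
by move: (gmean M N t) (gmean M' N' t) => X Y -> ->; rewrite lecR.
Qed.

(** Both exponents are positive, so each power is strictly increasing. A strict loss in one factor
    cannot be made up by the other, which is already bounded by its counterpart. *)
Lemma powR_mean_le_eq (a b x y t : R) : 0 < x <= a -> 0 < y <= b -> 0 < t < 1 ->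
  a `^ (1 - t) * b `^ t <= x `^ (1 - t) * y `^ t -> a <= x /\ b <= y.
Proof.
move=> /andP[x0 xa] /andP[y0 yb] /andP[t0 t1] le_ab.
have a0 : 0 < a by exact: lt_le_trans xa.
have b0 : 0 < b by exact: lt_le_trans yb.
have s0 : 0 < 1 - t by rewrite subr_gt0.
have leA : x `^ (1 - t) <= a `^ (1 - t) by apply: ge0_ler_powR; rewrite ?nnegrE // ltW.
have leB : y `^ t <= b `^ t by apply: ge0_ler_powR; rewrite ?nnegrE // ltW.
split; rewrite leNgt; apply/negP => lt_ab;
  move: le_ab; rewrite leNgt => /negP; apply.
  apply: (@lt_le_trans _ _ (a `^ (1 - t) * y `^ t)).
    by rewrite ltr_pM2r ?powR_gt0 // gt0_ltr_powR // nnegrE ltW.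
  by rewrite ler_wpM2l ?powR_ge0.
apply: (@le_lt_trans _ _ (a `^ (1 - t) * y `^ t)).
  by rewrite ler_wpM2r ?powR_ge0.
by rewrite ltr_pM2l ?powR_gt0 // gt0_ltr_powR // nnegrE ltW.
Qed.

(** The exponents 1 - t and t are nonnegative, so the determinant of the mean is monotone in both
    determinants. *)
Lemma det_gmean_le G F A B Ah Bh M N (t : R) : 0 <= t <= 1 ->
  maxdet_completion G A Ah -> maxdet_completion F B Bh ->
  pd_completion G A M -> pd_completion F B N ->
  \det (gmean M N t) <= \det (gmean Ah Bh t).
Proof.
move=> /andP[t0 t1] mA mB cM cN.
have AM := maxdet_completion_Re_le mA cM; have BN := maxdet_completion_Re_le mB cN.
case: mA mB cM cN => [[_ pA] _] [[_ pB] _] [_ pM] [_ pN].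
rewrite (det_gmean_leE t pM pN pA pB).
by apply: ler_pM; rewrite ?powR_ge0 //; apply: ge0_ler_powR;
  rewrite ?nnegrE ?subr_ge0 // ltW // Re_gt0 // det_pdmx_gt0.
Qed.

(* At the endpoints t = 0 and t = 1 the determinant controls only one of M, N,
   but the geometric mean depends on that one alone. *)
Lemma gmean_maxdet_uniq G F A B Ah Bh M N (t : R) : 0 <= t <= 1 ->
  maxdet_completion G A Ah -> maxdet_completion F B Bh ->
  pd_completion G A M -> pd_completion F B N ->
  \det (gmean Ah Bh t) <= \det (gmean M N t) -> gmean M N t = gmean Ah Bh t.
Proof.
move=> /andP[t0 t1] mA mB cM cN.
have AM := maxdet_completion_Re_le mA cM; have BN := maxdet_completion_Re_le mB cN.
have eqA := maxdet_completion_eq mA cM; have eqB := maxdet_completion_eq mB cN.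
case: mA mB cM cN => [[_ pA] _] [[_ pB] _] [_ pM] [_ pN].
have dA := Re_gt0 (det_pdmx_gt0 pA); have dB := Re_gt0 (det_pdmx_gt0 pB).
have dM := Re_gt0 (det_pdmx_gt0 pM); have dN := Re_gt0 (det_pdmx_gt0 pN).
rewrite (det_gmean_leE t pA pB pM pN) => le_det.
have [t0E|tn0] := eqVneq t 0.
  move: le_det; rewrite {}t0E subr0 (gmean0 _ pM) (gmean0 _ pA) => le_det.
  by apply: eqA; move: le_det; rewrite !powRr0 !mulr1 !powRr1 // ltW.
have [t1E|tn1] := eqVneq t 1.
  move: le_det; rewrite {}t1E subrr (gmean1 pM pN) (gmean1 pA pB) => le_det.
  by apply: eqB; move: le_det; rewrite !powRr0 !mul1r !powRr1 // ltW.
(* For t strictly between 0 and 1 both determinants must be maximal, which forces both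
   completions. *)
have [||| leA leB] := powR_mean_le_eq _ _ _ le_det.
- by rewrite dM.
- by rewrite dN.
- by rewrite lt0r tn0 t0 lt_neqAle tn1.
by rewrite (eqA leA) (eqB leB).
Qed.

End MaxGmean.

Theorem theorem6p10 (R : realType) (n : nat) (G F : rel 'I_n)
    (A B : 'M[complex R]_n) (t : R) :
  is_graph G -> is_graph F -> completable R G -> completable R F ->
  partial_pd G A -> partial_pd F B -> 0 <= t <= 1 ->
  (exists! H : 'M[complex R]_n,
     (exists M N, pd_completion G A M /\ pd_completion F B N /\ H = gmean M N t) /\
     (forall M N, pd_completion G A M -> pd_completion F B N ->
        \det (gmean M N t) <= \det H)) /\
  (exists! Ah, maxdet_completion G A Ah) /\
  (exists! Bh, maxdet_completion F B Bh) /\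
  (forall H Ah Bh,
     (exists M N, pd_completion G A M /\ pd_completion F B N /\ H = gmean M N t) ->
     (forall M N, pd_completion G A M -> pd_completion F B N ->
        \det (gmean M N t) <= \det H) ->
     maxdet_completion G A Ah -> maxdet_completion F B Bh ->
     H = gmean Ah Bh t).
Proof.
move=> gG gF compG compF pA pB t01.
have [Ah mA] := maxdet_completion_exists compG gG pA.
have [Bh mB] := maxdet_completion_exists compF gF pB.
(* Stated for arbitrary maximum determinant completions, this serves both the uniqueness of [H] and
   the final formula. *)
have uniqH H Ah' Bh' :
    (exists M N, pd_completion G A M /\ pd_completion F B N /\ H = gmean M N t) ->
    (forall M N, pd_completion G A M -> pd_completion F B N ->
       \det (gmean M N t) <= \det H) ->
    maxdet_completion G A Ah' -> maxdet_completion F B Bh' -> H = gmean Ah' Bh' t.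
  move=> [M [N [cM [cN ->]]]] maxH mA' mB'.
  apply: (gmean_maxdet_uniq t01 mA' mB' cM cN).
  by apply: maxH; [case: mA'|case: mB'].
split; [|split; [|split]].
- exists (gmean Ah Bh t); split.
    split; first by exists Ah, Bh; case: mA; case: mB.
    by move=> M N cM cN; exact: (det_gmean_le t01 mA mB cM cN).
  by move=> H [exH maxH]; apply/esym/uniqH.
- by exists Ah; split=> // M mM; exact: maxdet_completion_uniq mA mM.
- by exists Bh; split=> // M mM; exact: maxdet_completion_uniq mB mM.
- exact: uniqH.
Qed.
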